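(* Let $\rho$ and $\mu$ be two (Borel) probability measures on $\mathbb{R}$, neither of which is the Dirac mass at $0$. Suppose that $$\int_{\mathbb{R}}|z|\,d\mu(z)<+\infty .$$ If $\rho$ is symmetric, then $$H(\mu|\rho)\;\geq\;\frac{\left(\int_{\mathbb{R}}z\,d\mu(z)\right)^2}{2\int_{\mathbb{R}}z^2\,d\mu(z)},$$ with equality if and only if $\mu=\rho$. Here $H(\mu|\rho)\in[0,+\infty]$ is the relative entropy of $\mu$ with respect to $\rho$, and the right-hand side is understood to be $0$ when $\int_{\mathbb{R}}z^2\,d\mu(z)=+\infty$.
   Context: For probability measures $\mu,\rho$ on $\mathbb{R}$, the relative entropy of $\mu$ with respect to $\rho$ is $$H(\mu|\rho)=\int_{\mathbb{R}} f(z)\ln f(z)\,d\rho(z)\quad\text{if } \mu\ll\rho \text{ and } f=\frac{d\mu}{d\rho}\ \text{(Radon-Nikodym derivative)},$$ and $H(\mu|\rho)=+\infty$ otherwise, with the usual convention $0\ln 0=0$. A probability measure $\rho$ on $\mathbb{R}$ is symmetric if $\rho(-A)=\rho(A)$ for every Borel set $A\subset\mathbb{R}$. No moment or integrability condition is imposed on $\rho$. The second moment $\int_{\mathbb{R}}z^2\,d\mu(z)$ takes values in $(0,+\infty]$. *)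

(* Defs.v *)
From HB Require Import structures.
From mathcomp Require Import all_boot all_order all_algebra.
From mathcomp Require Import all_classical all_reals all_analysis giry.
Set Implicit Arguments.
Unset Strict Implicit.
Unset Printing Implicit Defensive.
Import Order.TTheory GRing.Theory Num.Theory.
Import numFieldNormedType.Exports.
Local Open Scope classical_set_scope.
Local Open Scope ring_scope.
Local Open Scope ereal_scope.
Local Open Scope charge_scope.

(* When [mu `<< rho], the derivative ['d mu '/d rho] is everywhere finite, so
   [fine] loses nothing. It is determined (and nonnegative) only rho-a.e., which
   does not affect the integral. The convention 0 ln 0 = 0 holds by [mul0r]. *)
Definition relative_entropy d (T : measurableType d) (R : realType)
    (mu rho : probability T R) : \bar R :=
  if pselect (mu `<< rho) then
    let f := fun z => fine (('d (charge_of_finite_measure mu) '/d rho) z) in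
    \int[rho]_z (f z * ln (f z))%R%:E
  else +oo.

Definition symmetric_probability (R : realType)
    (rho : probability (measurableTypeR R) R) : Prop :=
  forall A : set (measurableTypeR R), measurable A ->
    rho [set (- z)%R | z in A] = rho A.

(* Main.v *)
Require Import Defs.
From HB Require Import structures.
From mathcomp Require Import all_boot all_order all_algebra.
From mathcomp Require Import all_classical all_reals all_analysis giry.
From mathcomp Require Import measurable_realfun ring lra.
Import Order.TTheory GRing.Theory Num.Theory.
Import numFieldNormedType.Exports.
Local Open Scope classical_set_scope.
Local Open Scope ring_scope.

(** Relative entropy dominates every Gibbs functional: for each test function
phi, integrating against rho the pointwise Young inequality
[phi * g + g - expR phi <= g * ln g], where [g] is the density of mu, gives
  [\int phi dmu + 1 - \int expR phi drho <= H(mu|rho)]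
([gibbs_variational]). The Gaussian tilt
  [phi z = t * z - (t * z) ^+ 2 / 2],  [t = m / s],
with [m] and [s] the first two moments of mu, has mu-integral exactly
[m ^+ 2 / (2 * s)], so it only remains to see that [\int expR phi drho <= 1].
As rho is symmetric, this integral is that of
[cosh (t * z) * expR (- (t * z) ^+ 2 / 2)], and
[cosh x <= expR (x ^+ 2 / 2)], strictly for [x != 0]. The quadratic term also
keeps [phi] bounded above, so that [expR phi] is integrable for every
probability.

For the equality case, suppose [m != 0] and [s] finite. Then [t != 0], and
because rho is not the Dirac mass at 0 the exponential integral is strictly
below 1 ([symmetric_gauss_tilt_lt1]); the entropy strictly exceeds a
nonnegative bound, so neither equality nor [mu = rho], which would make the
entropy vanish, can occur. If [m = 0] or [s] is infinite, the bound is 0 and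
the claim is that entropy is nonnegative and vanishes exactly when the two
measures agree ([relative_entropy_ge0], [relative_entropy_eq0]), which follows
from the test function [phi = 0] and the equality case of Young's
inequality. *)

(** * Real inequalities *)

(** This is [tanh x < x] for positive [x], cleared of denominators: the
difference of the two sides vanishes at 0 and has derivative
[x * (expR x - expR (- x))]. It is the sign of the derivative in
[cosh_lt_gauss]. *)
Lemma tanh_lt_id {R : realType} {x : R} : 0 < x ->
  (1 - x) * expR x < (1 + x) * expR (- x).
Proof.
move=> x0.
pose g := fun y : R => (y - 1) * expR y + (y + 1) * expR (- y).
have dg (y : R) : is_derive y (1 : R) g (y * (expR y - expR (- y))).
  apply: is_derive_eq.
  by rewrite /GRing.scale /=; ring.
suff : g 0 < g x.
  rewrite /g oppr0 expR0; move: (expR x) (expR (- x)) => a b; nra.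
apply: (@gtr0_derive1_lt_cc _ g 0 x) => //.
- move=> y; rewrite in_itv/= => /andP[y0 _].
  rewrite derive1E (@derive_val _ _ _ _ _ _ _ (dg y)).
  by rewrite mulr_gt0// subr_gt0 ltr_expR gtrN.
- apply: derivable_within_continuous => y _.
  exact: (@ex_derive _ _ _ _ _ _ _ (dg y)).
- by rewrite in_itv/= lexx ltW.
- by rewrite in_itv/= lexx ltW.
Qed.

(** The bound [cosh x < expR (x ^+ 2 / 2)], with the Gaussian factor moved to
the left: the left-hand side is even, equals 2 at 0 and decreases on the
positive half-line. *)
Lemma cosh_lt_gauss {R : realType} (x : R) : x != 0 ->
  expR (x - x ^+ 2 / 2) + expR (- x - x ^+ 2 / 2) < 2.
Proof.
wlog x0 : x / 0 < x => [hwlog|] xn0.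
  case: (ltgtP x 0) => [xlt|/hwlog|x0]; [|exact|by rewrite x0 eqxx in xn0].
  by have := hwlog (- x); rewrite oppr_gt0 oppr_eq0 opprK sqrrN addrC; exact.
pose g := fun y : R => expR (y - y ^+ 2 / 2) + expR (- y - y ^+ 2 / 2).
have dg (y : R) : is_derive y (1 : R) g
    (expR (y - y ^+ 2 / 2) * (1 - y) - expR (- y - y ^+ 2 / 2) * (1 + y)).
  apply: is_derive_eq.
  by rewrite /GRing.scale /=; field.
suff : g x < g 0 by rewrite /g expr0n/= mul0r !subr0 oppr0 expR0.
apply: (@ltr0_derive1_lt_cc _ g 0 x) => //.
- move=> y; rewrite in_itv/= => /andP[y0 _].
  rewrite derive1E (@derive_val _ _ _ _ _ _ _ (dg y)).
  have := tanh_lt_id y0; rewrite !expRD.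
  move: (expR (- (_ / _))) (expR_gt0 (- (y ^+ 2 / 2))) => c c0 h.
  by rewrite -subr_gt0 in h; have := mulr_gt0 c0 h; lra.
- apply: derivable_within_continuous => y _.
  exact: (@ex_derive _ _ _ _ _ _ _ (dg y)).
- by rewrite in_itv/= lexx ltW.
- by rewrite in_itv/= lexx ltW.
Qed.

(** Young's inequality for the convex conjugate pair [f * ln f - f] and [expR p];
for positive [f] it is [1 + x <= expR x] at [x = p - ln f], multiplied by [f]. *)
Lemma entropy_young {R : realType} (f p : R) : 0 <= f ->
  0 <= f * ln f - (p * f + f - expR p).
Proof.
rewrite le_eqVlt => /predU1P[<-|f0].
  by rewrite mul0r mulr0 !add0r opprK expR_ge0.
have := expR_ge1Dx (p - ln f); rewrite expRB lnK ?posrE//.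
rewrite -(ler_pM2l f0) mulrCA divff ?gt_eqF//; lra.
Qed.

(** The gap of [entropy_young] at [p = 0] closes only at [f = 1], by the strict
inequality [1 + x < expR x] at [x = - ln f]. *)
Lemma entropy_young_eq1 {R : realType} (f : R) : 0 <= f ->
  f * ln f - f + 1 = 0 -> f = 1.
Proof.
rewrite le_eqVlt => /predU1P[<-|f0]; first by rewrite mul0r; lra.
have [lf0 _|lf0] := eqVneq (ln f) 0.
  by apply/eqP; rewrite -ln_eq0 ?lf0.
have : 1 - ln f < expR (- ln f) by rewrite expR_gt1Dx// oppr_eq0.
rewrite expRN lnK ?posrE// -(ltr_pM2l f0) divff ?gt_eqF//; lra.
Qed.

Local Open Scope ereal_scope.

(** * Gibbs variational inequality *)

(** Additivity also holds when the nonnegative summand has infinite integral: the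
negative part of the sum is dominated by [`|k|], so that both sides are then
[+oo]. This lets the entropy be split without knowing whether it is
finite. *)
Lemma integralD_ge0_integrable {d} {T : measurableType d} {R : realType}
    (m : {measure set T -> \bar R}) (f k : T -> R) :
  measurable_fun [set: T] f -> (forall x, 0 <= f x)%R ->
  m.-integrable [set: T] (EFin \o k) ->
  \int[m]_x (f x + k x)%:E = \int[m]_x (f x)%:E + \int[m]_x (k x)%:E.
Proof.
move=> mf f0 ik.
have mk : measurable_fun [set: T] k.
  exact/measurable_EFinP/(measurable_int _ ik).
have mEf : measurable_fun [set: T] (EFin \o f) by exact/measurable_EFinP.
have mfk : measurable_fun [set: T] (EFin \o (f \+ k)%R).
  by apply/measurable_EFinP; exact: measurable_funD.
have ik_abs : \int[m]_x `|(k x)%:E| < +oo by case/integrableP : ik.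
have [fi|] := ltP (\int[m]_x (f x)%:E) +oo.
  under eq_integral do rewrite EFinD.
  apply: (integralD measurableT) => //; apply/integrableP; split => //.
  by under eq_integral do rewrite /= ger0_norm//.
rewrite leye_eq => /eqP foo.
rewrite foo addye; last by rewrite gt_eqF// ltNye_eq integrable_fin_num.
rewrite integralE -[X in X - _ = _]/(\int[m]_x (EFin \o (f \+ k)%R)^\+ x).
have -> : \int[m]_x (EFin \o (f \+ k)%R)^\+ x = +oo.
  apply/eqP; rewrite -leye_eq leNgt; apply/negP => poslt.
  have : \int[m]_x (f x)%:E < +oo; last by rewrite foo.
  apply: (@le_lt_trans _ _
    (\int[m]_x ((EFin \o (f \+ k)%R)^\+ x + `|(k x)%:E|))); last first.
    rewrite ge0_integralD//; first exact: lte_add_pinfty.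
    - exact: measurable_funepos.
    - exact/measurableT_comp/measurable_EFinP.
  apply: ge0_le_integral => //.
  - by move=> x _; rewrite lee_fin.
  - apply: emeasurable_funD; first exact: measurable_funepos.
    exact/measurableT_comp/measurable_EFinP.
  - move=> x _; rewrite funeposE/= -EFin_max -EFinD lee_fin.
    have : (f x + k x <= Num.max (f x + k x) 0)%R by rewrite le_max lexx.
    have := ler_norm (- k x); rewrite normrN; lra.
apply/addye; rewrite eqe_oppLR/= lt_eqF//.
apply: le_lt_trans ik_abs; apply: ge0_le_integral => //.
- exact: measurable_funeneg.
- exact/measurableT_comp/measurable_EFinP.
- move=> x _; rewrite funenegE/= -EFin_max lee_fin ge_max normr_ge0 andbT.
  have := ler_norm (- k x); rewrite normrN; have := f0 x; lra.
Qed.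

(** The derivative in the definition of relative entropy comes from a charge and
is nonnegative only almost everywhere; a version of it that is nonnegative
everywhere makes pointwise inequalities available without exceptional
sets. *)
Lemma entropy_density {d} {T : measurableType d} {R : realType}
    {mu rho : probability T R} : mu `<< rho ->
  exists g : T -> R,
    [/\ rho.-integrable [set: T] (EFin \o g), (forall x, 0 <= g x)%R,
        forall A, measurable A -> mu A = \int[rho]_(x in A) (g x)%:E,
        relative_entropy mu rho = \int[rho]_x (g x * ln (g x))%:E &
        forall phi : T -> R, mu.-integrable [set: T] (EFin \o phi) ->
          rho.-integrable [set: T] (EFin \o (fun x => phi x * g x)%R) /\
          \int[rho]_x (phi x * g x)%:E = \int[mu]_x (phi x)%:E].
Proof.
move=> murho.
pose f := Radon_Nikodym_SigmaFinite.f mu rho.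
have fE x : (fine (f x))%:E = f x.
  by rewrite fineK//; exact: Radon_Nikodym_SigmaFinite.f_fin_num.
have mf : measurable_fun [set: T] f.
  exact: measurable_int (Radon_Nikodym_SigmaFinite.f_integrable murho).
exists (fine \o f); split.
- rewrite (_ : EFin \o _ = f); last by apply/funext => x; exact: fE.
  exact: Radon_Nikodym_SigmaFinite.f_integrable.
- by move=> x /=; rewrite fine_ge0// Radon_Nikodym_SigmaFinite.f_ge0.
- move=> A mA; rewrite (Radon_Nikodym_SigmaFinite.f_integral murho mA).
  by apply: eq_integral => x _ /=; rewrite fE.
- rewrite /relative_entropy; case: pselect => //= _.
  have mxlnx (u : T -> \bar R) : measurable_fun [set: T] u ->
      measurable_fun [set: T] (fun x => (fine (u x) * ln (fine (u x)))%:E).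
    move=> umeas.
    have mfu : measurable_fun [set: T] (fine \o u) by exact: measurableT_comp.
    apply: (measurableT_comp (@EFin_measurable R setT)).
    exact: measurable_funM mfu (measurableT_comp (@measurable_ln R) mfu).
  apply: ae_eq_integral => //.
  + by apply: mxlnx; apply: measurable_int; exact: Radon_Nikodym_integrable.
  + exact: mxlnx.
  + apply: (ae_eq_comp (fun y : \bar R => (fine y * ln (fine y))%:E)).
    exact/ae_eq_sym/ae_eq_Radon_Nikodym_SigmaFinite.
- move=> phi iphi.
  have phigE : EFin \o (fun x => phi x * (fine \o f) x)%R
      = (EFin \o phi) \* f.
    by apply/funext => x /=; rewrite EFinM fE.
  have mphi : measurable_fun [set: T] (EFin \o phi) by exact: measurable_int iphi.
  split.
    rewrite phigE.
    apply: (@le_integrable _ _ _ _ _ _ _ ((abse \o (EFin \o phi)) \* f)) => //.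
    + exact: emeasurable_funM.
    + by move=> x _; rewrite !abseM /= normr_id.
    + apply: Radon_Nikodym_SigmaFinite.integrableM => //; last exact: integrable_abse.
      by move=> x; exact: abse_ge0.
  rewrite -(Radon_Nikodym_change_of_variables murho measurableT iphi).
  rewrite -[LHS]/(\int[rho]_x (EFin \o (fun x => phi x * (fine \o f) x)%R) x).
  rewrite phigE; apply: ae_eq_integral => //.
  + exact: emeasurable_funM.
  + exact: emeasurable_funM.
  + exact/ae_eqe_mul2l/ae_eq_Radon_Nikodym_SigmaFinite.
Qed.

Definition young_gap {R : realType} {T : Type} (phi g : T -> R) (x : T) : R :=
  (g x * ln (g x) - (phi x * g x + g x - expR (phi x)))%R.

Lemma measurable_young_gap {d} {T : measurableType d} {R : realType} (phi g : T -> R) :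
  measurable_fun [set: T] phi -> measurable_fun [set: T] g ->
  measurable_fun [set: T] (young_gap phi g).
Proof.
move=> mphi mg; apply: measurable_funB.
  by apply: measurable_funM => //; exact: measurableT_comp.
apply: measurable_funB; last exact: measurableT_comp.
by apply: measurable_funD => //; exact: measurable_funM.
Qed.

(** The entropy exceeds the Gibbs functional of [phi] by exactly the integral of
the nonnegative Young gap. Keeping the gap, rather than discarding it at once,
gives both the variational inequality and, for [phi = 0], its equality case.
The subtracted terms are integrable, so the identity holds even if the entropy
is infinite. *)
Lemma relative_entropy_gap {d} {T : measurableType d} {R : realType}
    {mu rho : probability T R} (phi : T -> R) : mu `<< rho ->
    mu.-integrable [set: T] (EFin \o phi) ->
    rho.-integrable [set: T] (EFin \o (expR \o phi)) ->
  exists g : T -> R,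
    [/\ measurable_fun [set: T] g, (forall x, 0 <= g x)%R,
        forall A, measurable A -> mu A = \int[rho]_(x in A) (g x)%:E &
        relative_entropy mu rho = \int[rho]_x (young_gap phi g x)%:E +
          (\int[mu]_x (phi x)%:E + 1 - \int[rho]_x (expR (phi x))%:E)].
Proof.
move=> murho iphi iexp.
have [g [ig g0 mug -> chg]] := entropy_density murho.
have mg : measurable_fun [set: T] g.
  by apply/measurable_EFinP; exact: measurable_int ig.
have [iphig phigE] := chg _ iphi.
exists g; split => //.
have mphi : measurable_fun [set: T] phi.
  by apply/measurable_EFinP; exact: measurable_int iphi.
pose k := fun x => (phi x * g x + g x - expR (phi x))%R.
have iphiDg : rho.-integrable [set: T] (EFin \o (fun x => phi x * g x + g x)%R).
  exact: (integrableD measurableT iphig ig).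
have ik : rho.-integrable [set: T] (EFin \o k).
  exact: (integrableB measurableT iphiDg iexp).
transitivity (\int[rho]_x (young_gap phi g x + k x)%:E).
  by apply: eq_integral => x _; rewrite /young_gap subrK.
rewrite integralD_ge0_integrable//; last 2 first.
- exact: measurable_young_gap.
- by move=> x; exact: entropy_young.
congr (_ + _).
transitivity (\int[rho]_x (phi x * g x + g x)%:E - \int[rho]_x (expR (phi x))%:E).
  by rewrite -integralB_EFin.
congr (_ - _); under eq_integral do rewrite EFinD.
by rewrite (integralD measurableT iphig ig)/= phigE -mug// probability_setT.
Qed.

Lemma gibbs_variational {d} {T : measurableType d} {R : realType}
    {mu rho : probability T R} (phi : T -> R) :
    mu.-integrable [set: T] (EFin \o phi) ->
    rho.-integrable [set: T] (EFin \o (expR \o phi)) ->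
  \int[mu]_x (phi x)%:E + 1 - \int[rho]_x (expR (phi x))%:E
    <= relative_entropy mu rho.
Proof.
move=> iphi iexp; have [murho|nmurho] := pselect (mu `<< rho); last first.
  by rewrite /relative_entropy; case: pselect => //= _; rewrite leey.
have [g [mg g0 mug ->]] := relative_entropy_gap _ murho iphi iexp.
by rewrite leeDr// integral_ge0// => x _; rewrite lee_fin; exact: entropy_young.
Qed.

Lemma gibbs_cst0 {d} {T : measurableType d} {R : realType}
    (mu rho : probability T R) :
  [/\ mu.-integrable [set: T] (EFin \o (cst 0%R : T -> R)),
    rho.-integrable [set: T] (EFin \o (expR \o (cst 0%R : T -> R))) &
   \int[mu]_x ((cst 0%R : T -> R) x)%:E + 1
     - \int[rho]_x (expR ((cst 0%R : T -> R) x))%:E = 0].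
Proof.
split; first exact: integrable0.
  exact: (finite_measure_integrable_cst rho (expR 0)%R).
under [X in _ - X]eq_integral do rewrite /= expR0.
by rewrite integral0 add0e integral_cst// mul1e [X in _ - X]probability_setT subee.
Qed.

Lemma relative_entropy_ge0 {d} {T : measurableType d} {R : realType}
    (mu rho : probability T R) : 0 <= relative_entropy mu rho.
Proof.
have [i0 i1 <-] := gibbs_cst0 mu rho.
exact: gibbs_variational.
Qed.

(** Zero entropy forces the Young gap at [phi = 0] to vanish almost everywhere,
hence the density to be 1. Conversely, equal measures have density 1, and
[ln 1 = 0]. *)
Lemma relative_entropy_eq0 {d} {T : measurableType d} {R : realType}
    (mu rho : probability T R) :
  relative_entropy mu rho = 0 <-> measure_eq mu rho.
Proof.
split=> [H0|eqmr].
  have [murho|nmurho] := pselect (mu `<< rho); last first.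
    by move: H0; rewrite /relative_entropy; case: pselect.
  have [i0 i1 e0] := gibbs_cst0 mu rho.
  have [g [mg g0 mug]] := relative_entropy_gap _ murho i0 i1.
  rewrite H0 e0 adde0 => /esym gap0.
  have mgap : measurable_fun [set: T] (EFin \o young_gap (cst 0%R) g).
    by apply/measurable_EFinP; exact: measurable_young_gap.
  have : ae_eq rho [set: T] (EFin \o young_gap (cst 0%R) g) (cst 0).
    apply/ae_eq_integral_abs => //; rewrite -[RHS]gap0; apply: eq_integral => x _.
    by rewrite gee0_abs// lee_fin; exact: entropy_young.
  move=> gap_ae A mA; rewrite [LHS]mug//.
  rewrite -[RHS]mul1e -(integral_cst _ mA); apply: ae_eq_integral => //.
    by apply/measurable_EFinP; exact: measurable_funTS.
  apply: filterS gap_ae => x /(_ I)[gapx] _ /=; congr EFin.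
  apply: entropy_young_eq1 => //; move: gapx; rewrite /young_gap/= expR0; lra.
have murho : mu `<< rho.
  by move=> N rhoN A mA AN; rewrite [LHS]eqmr//; exact: rhoN.
have [g [ig _ mug -> _]] := entropy_density murho.
have mg : measurable_fun [set: T] g.
  by apply/measurable_EFinP; exact: measurable_int ig.
have g1 : ae_eq rho [set: T] (EFin \o g) (cst 1).
  apply: integral_ae_eq => // A _ mA.
  by rewrite integral_cst// mul1e -[LHS]mug//; exact: eqmr.
rewrite (ae_eq_integral (cst 0)) ?integral0//.
  apply: measurableT_comp => //; apply: measurable_funM => //; exact: measurableT_comp.
by apply: filterS g1 => x /(_ I)[->] _; rewrite ln1 mulr0.
Qed.

(** * Symmetric probabilities and the Gaussian tilt *)

(** A probability that charges only the zeros of [h], here contained in the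
singleton 0, is the Dirac mass at 0. It is used with [h z = z ^+ 2] for mu, and
with the gap in the symmetrised [cosh] inequality for rho. *)
Lemma null_integral_dirac0 {R : realType}
    (P : probability (measurableTypeR R) R) (h : measurableTypeR R -> R) :
  measurable_fun [set: measurableTypeR R] h -> (forall z, 0 <= h z)%R ->
  (forall z, h z = 0 -> z = 0)%R ->
  \int[P]_z (h z)%:E = 0 ->
  measure_eq P (dirac (0%R : measurableTypeR R)).
Proof.
move=> mh h0 hz ih0 A mA.
have mEh : measurable_fun [set: measurableTypeR R] (EFin \o h).
  exact/measurable_EFinP.
have h_ae : ae_eq P [set: measurableTypeR R] (EFin \o h) (cst 0).
  apply/ae_eq_integral_abs => //; rewrite -[RHS]ih0; apply: eq_integral => x _.
  by rewrite gee0_abs// lee_fin.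
have nullP (B : set (measurableTypeR R)) : measurable B -> ~ B 0%R -> P B = 0.
  move=> mB B0; apply: (negligible_null_set _ mB (@subset_refl _ B)).
  apply: negligibleS h_ae => z Bz /= /(_ I)[/hz z0].
  by apply: B0; rewrite -z0.
rewrite [RHS]diracE.
have [A0|A0] := boolP (0%R \in A); last first.
  by apply: nullP => //; move/negP: A0; rewrite inE.
suff PA1 : P A = 1 by exact: PA1.
have := probability_setC P mA.
rewrite nullP; last 2 first.
- exact: measurableC.
- by move: A0; rewrite inE => A0 /(_ A0).
have := fin_num_measure P A mA; case: (P A) => // r _ [] /eqP.
by rewrite eq_sym subr_eq0 => /eqP <-.
Qed.

(** Symmetry says that rho agrees with its pushforward under negation, since the
preimage and the image of a set under negation coincide. *)
Lemma symmetric_integralN {R : realType}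
    (rho : probability (measurableTypeR R) R) (h : measurableTypeR R -> R) :
  symmetric_probability rho ->
  measurable_fun [set: measurableTypeR R] h ->
  rho.-integrable [set: measurableTypeR R] (EFin \o (fun z => h (- z)%R)) ->
  \int[rho]_z (h (- z))%:E = \int[rho]_z (h z)%:E.
Proof.
move=> rho_sym mh ih.
have mN : measurable_fun [set: measurableTypeR R]
  ((fun z => - z)%R : measurableTypeR R -> measurableTypeR R).
  exact: oppr_measurable.
have mEh : measurable_fun [set: measurableTypeR R] (EFin \o h).
  exact/measurable_EFinP.
have := @integral_pushforward _ _ _ _ _ _ mN rho setT (EFin \o h) mEh.
rewrite preimage_setT => /(_ ih measurableT) /= <-.
apply: eq_measure_integral => A mA _.
transitivity (rho [set (- z)%R | z in A]); last exact: rho_sym.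
rewrite /pushforward; congr (rho _).
apply/seteqP; split => z /=; last by move=> [y Ay <-]; rewrite opprK.
by move=> Az; exists (- z)%R => //; rewrite opprK.
Qed.

(** Since [(t * z - 1) ^+ 2] is nonnegative, the exponent is at most 1/2, so the
integrand is bounded. *)
Lemma integrable_gauss_tilt {R : realType}
    (rho : probability (measurableTypeR R) R) (t : R) :
  rho.-integrable [set: measurableTypeR R]
    (EFin \o (fun z => expR (t * z - (t * z) ^+ 2 / 2))).
Proof.
apply: (@le_integrable _ _ _ _ _ measurableT _ (EFin \o cst (expR 1))).
- apply/measurable_EFinP; apply: measurableT_comp => //.
  apply: measurable_funB; first exact: mulrl_measurable.
  apply: measurable_funM => //; apply: measurable_funX.
  exact: mulrl_measurable.
- move=> z _ /=; rewrite lee_fin !ger0_norm ?expR_ge0// ler_expR.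
  by have := sqr_ge0 (t * z - 1)%R; rewrite sqrrB1; lra.
- exact: finite_measure_integrable_cst.
Qed.

(** Averaging the integrand over [z] and [- z] produces
[cosh (t * z) * expR (- (t * z) ^+ 2 / 2)], which is less than 1 off 0; the
integral can therefore be 1 only if rho is concentrated at 0. *)
Lemma symmetric_gauss_tilt_lt1 {R : realType}
    (rho : probability (measurableTypeR R) R) (t : R) :
  symmetric_probability rho ->
  ~ measure_eq rho (dirac (0%R : measurableTypeR R)) -> t != 0%R ->
  \int[rho]_z (expR (t * z - (t * z) ^+ 2 / 2))%:E < 1.
Proof.
move=> rho_sym rho0 t0.
pose e z : R := expR (t * z - (t * z) ^+ 2 / 2).
have ie := integrable_gauss_tilt rho t.
have ieN : rho.-integrable [set: measurableTypeR R]
    (EFin \o (fun z => e (- z)%R)).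
  have := integrable_gauss_tilt rho (- t)%R; congr (_.-integrable _ _).
  by apply/funext => z /=; rewrite /e mulrN mulNr.
have me : measurable_fun [set: measurableTypeR R] e.
  by apply/measurable_EFinP; exact: measurable_int ie.
have meN : measurable_fun [set: measurableTypeR R] (fun z => e (- z)%R).
  by apply/measurable_EFinP; exact: measurable_int ieN.
pose h z : R := (2 - (e z + e (- z)))%R.
have hgt z : z != 0%R -> (0 < h z)%R.
  move=> z0; rewrite subr_gt0 /e mulrN sqrrN.
  by apply: cosh_lt_gauss; rewrite mulf_neq0.
have h00 : h 0%R = 0%R by rewrite /h /e oppr0 mulr0 expr0n/= mul0r subr0 expR0; lra.
have h0 z : (0 <= h z)%R.
  by have [->|/hgt/ltW//] := eqVneq z 0%R; rewrite h00.
have hz z : h z = 0%R -> z = 0%R.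
  by move=> hz0; apply/eqP; apply: contra_eqT hz0 => /hgt/gt_eqF ->.
have mh : measurable_fun [set: measurableTypeR R] h.
  by apply: measurable_funB => //; exact: measurable_funD.
have ih : \int[rho]_z (h z)%:E = 2%:E - (\int[rho]_z (e z)%:E + \int[rho]_z (e z)%:E).
  rewrite /h integralB_EFin//; last 2 first.
  - exact: finite_measure_integrable_cst.
  - exact: (integrableD measurableT ie ieN).
  congr (_ - _).
    by rewrite (integral_cst rho measurableT) [X in _ * X]probability_setT mule1.
  under eq_integral do rewrite EFinD.
  rewrite (integralD measurableT ie ieN); congr (_ + _).
  exact: symmetric_integralN.
have ih_neq0 : \int[rho]_z (h z)%:E != 0.
  by apply/eqP => ih0; apply: rho0; exact: (null_integral_dirac0 _ h).
have : 0 < \int[rho]_z (h z)%:E.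
  by rewrite lt_def ih_neq0/= integral_ge0// => z _; rewrite lee_fin.
have := integrable_fin_num measurableT ie.
rewrite ih -/e -[\int[rho]_z (EFin \o _) z]/(\int[rho]_z (e z)%:E).
case: (\int[rho]_z (e z)%:E) => // r _.
by rewrite !lte_fin; lra.
Qed.

(* Equality of measures is [measure_eq], i.e. equality on measurable sets:
   Leibniz equality would also compare the values at non-measurable sets.
   Division is that of [\bar R], for which [+oo^-1 = 0]. *)
Theorem mainTheorem1 (R : realType)
    (rho mu : probability (measurableTypeR R) R)
    (rho_neq_dirac0 : ~ measure_eq rho (dirac (0%R : measurableTypeR R)))
    (mu_neq_dirac0 : ~ measure_eq mu (dirac (0%R : measurableTypeR R)))
    (mu_int : \int[mu]_z `|z|%:E < +oo)
    (rho_sym : symmetric_probability rho) :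
  let bound := (\int[mu]_z z%:E) ^+ 2 / (2%:E * \int[mu]_z (z ^+ 2)%:E) in
  bound <= relative_entropy mu rho /\
  (relative_entropy mu rho = bound <-> measure_eq mu rho).
Proof.
move=> bound.
have msq : measurable_fun [set: measurableTypeR R] (fun z : R => z ^+ 2)%R.
  exact: measurable_funX.
have iz : mu.-integrable [set: measurableTypeR R] (EFin \o (fun z : R => z)).
  by apply/integrableP; split => //; exact/measurable_EFinP.
have [m mE] : exists m, \int[mu]_z z%:E = m%:E.
  by exists (fine (\int[mu]_z z%:E)); rewrite fineK//; exact: integrable_fin_num iz.
have s0 : 0 <= \int[mu]_z (z ^+ 2)%:E.
  by apply: integral_ge0 => z _; rewrite lee_fin sqr_ge0.
have bound0 : bound = 0 -> bound <= relative_entropy mu rho /\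
    (relative_entropy mu rho = bound <-> measure_eq mu rho).
  by move=> ->; split; [exact: relative_entropy_ge0|exact: relative_entropy_eq0].
have [soo|] := eqVneq (\int[mu]_z (z ^+ 2)%:E) +oo.
  by apply: bound0; rewrite /bound soo gt0_muley ?lte_fin// invey mule0.
have [m0 _|m0 snoo] := eqVneq m 0%R.
  by apply: bound0; rewrite /bound mE m0 expe2 mule0 mul0e.
have isq : mu.-integrable [set: measurableTypeR R] (EFin \o (fun z : R => z ^+ 2)%R).
  apply/integrableP; split; first exact/measurable_EFinP.
  under eq_integral do rewrite /= ger0_norm ?sqr_ge0//.
  by rewrite ltey.
have sn0 : \int[mu]_z (z ^+ 2)%:E != 0.
  apply/eqP => s00; apply: mu_neq_dirac0.
  apply: (null_integral_dirac0 _ (fun z => z ^+ 2)%R) => //.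
    by move=> z; exact: sqr_ge0.
  by move=> z /eqP; rewrite sqrf_eq0 => /eqP.
have [s sE] : exists s, \int[mu]_z (z ^+ 2)%:E = s%:E.
  by exists (fine (\int[mu]_z (z ^+ 2)%:E)); rewrite fineK//; exact: integrable_fin_num isq.
have sgt0 : (0 < s)%R by rewrite -lte_fin -sE lt_def sn0.
have boundE : bound = (m ^+ 2 / (2 * s))%:E.
  by rewrite /bound mE sE expe2 -!EFinM inver mulf_eq0 pnatr_eq0/= gt_eqF.
(* [m / s] maximises [t * m - t ^+ 2 * s / 2], the mu-integral of the tilt. *)
pose t := (m / s)%R.
have t0 : t != 0%R by rewrite mulf_neq0// invr_eq0 gt_eqF.
pose phi (z : R) : R := (t * z - (t * z) ^+ 2 / 2)%R.
have phiE : EFin \o phi =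
    (fun z : R => t%:E * z%:E) \- (fun z : R => (t ^+ 2 / 2)%:E * (z ^+ 2)%:E).
  by apply/funext => z /=; rewrite -EFinM -EFinD /phi; congr EFin; ring.
have itz := integrableZl measurableT t iz.
have itsq := integrableZl measurableT (t ^+ 2 / 2)%R isq.
have iphi : mu.-integrable [set: measurableTypeR R] (EFin \o phi).
  by rewrite phiE; exact: integrableB.
have phi_int : \int[mu]_z (phi z)%:E = bound.
  rewrite -[LHS]/(\int[mu]_z (EFin \o phi) z) phiE integralB//.
  rewrite (integralZl measurableT iz) (integralZl measurableT isq)/=.
  rewrite mE sE boundE -!EFinM -EFinB; congr EFin; rewrite /t; field.
  by rewrite gt_eqF.
have := gibbs_variational _ iphi (integrable_gauss_tilt rho t).
have := symmetric_gauss_tilt_lt1 rho t rho_sym rho_neq_dirac0 t0.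
have := integrable_fin_num measurableT (integrable_gauss_tilt rho t).
rewrite -[\int[rho]_z (EFin \o _) z]/(\int[rho]_z (expR (phi z))%:E).
rewrite phi_int -/(phi _).
case: (\int[rho]_z (expR (phi z))%:E) => // r _ r1 gibbs.
have bound_lt : bound < relative_entropy mu rho.
  apply: lt_le_trans gibbs; rewrite boundE -!EFinD lte_fin.
  by move: r1; rewrite lte_fin; lra.
split; first exact: ltW.
split=> [eqH|mu_rho]; first by move: bound_lt; rewrite eqH ltxx.
have /relative_entropy_eq0 H0 := mu_rho.
move: bound_lt; rewrite H0 boundE lte_fin ltNge divr_ge0 ?sqr_ge0//.
by rewrite mulr_ge0// ltW.
Qed.
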